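(* For $n\ge 1$ let $c_n$ be the number of level one cheesy polyominoes (on the hexagonal tiling, counted up to translation) having exactly $n$ cells. Then there exist real constants $\kappa$ and $\lambda$, with decimal expansions $\kappa=0.144176\ldots$ and $\lambda=4.114907\ldots$ (i.e. $0.144176\le\kappa<0.144177$ and $4.114907\le\lambda<4.114908$), such that $$c_n\sim \kappa\,\lambda^n\qquad (n\to\infty),$$ i.e. $\lim_{n\to\infty} c_n/(\kappa\lambda^n)=1$.
   Context: Consider the regular hexagonal tiling of the Euclidean plane, oriented so that every hexagonal tile has two horizontal edges; tiles are called cells. A (hexagonal-celled) polyomino is a union of finitely many (at least one) cells whose interior is connected (for unions of hexagonal cells, this is equivalent to the union being connected). Two polyominoes are considered equal if and only if one is the image of the other under a translation. The cells of a polyomino $P$ are partitioned according to their horizontal projection (cells with the same projection onto the horizontal axis lie in the same block); each block is a column of $P$. Cells of the tiling with the same horizontal projection are stacked vertically, consecutive ones sharing a horizontal edge. A column need not be a connected set; its connected components are its maximal runs of vertically consecutive cells. If a column has two connected components, the gap (hole) between them is the set of cells of the tiling lying in that vertical stack strictly between the two components. Columns are ordered from left to right; the first column is the leftmost one, and two columns are adjacent if they are consecutive in this order. A polyomino $P$ is rightward-semi-directed if the first (leftmost) column of $P$ has no gap (i.e. is connected) and, in every pair of adjacent columns of $P$, every connected component of the right column has at least one edge in common with the left column. For an integer $m\ge 1$, a polyomino $P$ is a level $m$ cheesy polyomino if: (i) $P$ is rightward-semi-directed; (ii) every column of $P$ has at most two connected components; (iii) if a column of $P$ has two connected components, then the gap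 between the components consists of at most $m$ cells. *)

(* Defs.v *)
From HB Require Import structures.
From mathcomp Require Import all_boot all_order all_algebra finmap.
From mathcomp Require Import all_classical all_reals all_analysis.

Set Implicit Arguments.
Unset Strict Implicit.
Unset Printing Implicit Defensive.

Import Order.TTheory GRing.Theory Num.Theory.
Import numFieldNormedType.Exports.

Local Open Scope classical_set_scope.
Local Open Scope card_scope.
Local Open Scope fset_scope.
Local Open Scope ring_scope.

(* The hexagon (x, y) is the one centred at x * u + y * v, where v is the     *)
(* vertical unit translation (from a tile to the tile stacked on it) and u    *)
(* the translation from a tile to its upper-right neighbour. Hence the first  *)
(* coordinate determines the horizontal projection of a cell, the second one  *)
(* its rank in its vertical stack, the six tiles sharing an edge with (x, y)  *)
(* are its translates by +/- v, +/- u, +/- (u - v), and the translations      *)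
(* preserving the tiling are those of the group int * int.                    *)
Definition cell := (int * int)%type.

Definition hex_steps : seq cell :=
  [:: (0, 1); (0, -1); (1, 0); (-1, 0); (1, -1); (-1, 1)].

Definition share_edge (c d : cell) : bool := (d - c) \in hex_steps.

Definition adj_in (S : {fset cell}) (c d : S) : bool :=
  share_edge (val c) (val d).

Definition component (S : {fset cell}) (c : S) : {fset cell} :=
  [fset val d | d : S & connect (@adj_in S) c d].

Definition components (S : {fset cell}) : {fset {fset cell}} :=
  [fset component c | c : S].

Definition polyomino (P : {fset cell}) : Prop :=
  P != fset0 /\ forall c d : P, connect (@adj_in P) c d.

Definition translate (v : cell) (P : {fset cell}) : {fset cell} :=
  [fset v + c | c in P].

Definition translation_class (P : {fset cell}) : set {fset cell} :=
  [set translate v P | v in [set: cell]].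

Definition column (P : {fset cell}) (i : int) : {fset cell} :=
  [fset c in P | c.1 == i].

Definition first_column (P : {fset cell}) (i : int) : Prop :=
  column P i != fset0 /\ forall k : int, k < i -> column P k = fset0.

Definition adjacent_columns (P : {fset cell}) (i j : int) : Prop :=
  [/\ i < j, column P i != fset0, column P j != fset0 &
      forall k : int, i < k -> k < j -> column P k = fset0].

(* The cells of the i-th vertical stack lying above K and below L; this set   *)
(* is empty when K and L are nonempty subsets of that stack and K is above L. *)
Definition gap (i : int) (K L : {fset cell}) : set cell :=
  [set c | [/\ c.1 = i, forall a, a \in K -> a.2 < c.2
             & forall b, b \in L -> c.2 < b.2]].

Definition rightward_semi_directed (P : {fset cell}) : Prop :=
  (forall i, first_column P i -> #|` components (column P i)| = 1%N) /\
  (forall i j, adjacent_columns P i j ->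
     forall K, K \in components (column P j) ->
       exists c d : cell,
         [/\ c \in column P i, d \in K & share_edge c d]).

Definition cheesy (m : nat) (P : {fset cell}) : Prop :=
  [/\ polyomino P,
      rightward_semi_directed P,
      forall i, (#|` components (column P i)| <= 2)%N
    & forall i (K L : {fset cell}),
        K \in components (column P i) -> L \in components (column P i) ->
        K != L -> gap i K L #<= `I_m].

Definition cheesy_classes (m n : nat) : set (set {fset cell}) :=
  [set translation_class P | P in [set P | cheesy m P /\ #|` P| = n]].

(* fset_set is empty on infinite sets, so a nonzero count certifies           *)
(* finiteness.                                                                *)
Definition cheesy_count (m n : nat) : nat :=
  #|` fset_set (cheesy_classes m n)|.

(* Main.v *)
(* Between two columns of hexagonal cells, the cell of rank y touches those of rank y and y - 1 of
   the next stack.  Hence a column made of one run of k cells, or of two runs of k cells in all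
   separated by a gap of one cell, touches an interval of the next stack, of size w = k + 1 or
   w = k + 2.  It can be followed by a one-run column of j cells in w + j - 1 ways, and by a two-run
   column of j cells in (j - 1) (w - 2) ways.  These numbers are affine in w, so the number of ways
   to complete a polyomino by n cells after such a column is p_n w + q_n, and summation shows that
   c_(n+3) = 6 c_(n+2) - 8 c_(n+1) + c_n.  The characteristic polynomial x^3 - 6 x^2 + 8 x - 1 has
   three real roots, one in ]0, 1[, one in ]3/2, 2[ and lambda = 4.114907..., and
   kappa = (lambda^2 - 5 lambda + 5) / (3 lambda^2 - 12 lambda + 8). *)
Require Import Defs.
From HB Require Import structures.
From mathcomp Require Import all_boot all_order all_algebra finmap.
From mathcomp Require Import all_classical all_reals all_analysis.
From mathcomp Require Import zify ring lra.
Import Order.TTheory GRing.Theory Num.Theory.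
Import numFieldNormedType.Exports.
Local Open Scope classical_set_scope.
Local Open Scope fset_scope.
Local Open Scope ring_scope.

(** * Runs and connectedness *)

Definition run (x y : int) (a : nat) : {fset cell} :=
  [fset (x, y + (nat_of_ord k)%:Z) | k in @predT 'I_a].

Lemma in_run (x y : int) (a : nat) (c : cell) :
  (c \in run x y a) = (c.1 == x) && (y <= c.2 < y + a%:Z).
Proof.
apply/imfsetP/idP => [[k _ ->]|].
  by rewrite /= eqxx /=; have := ltn_ord k; lia.
case: c => u v /= /andP[/eqP-> h].
have hk : (`|v - y|%N < a)%N by lia.
by exists (Ordinal hk) => //=; congr pair; lia.
Qed.

Lemma card_run (x y : int) (a : nat) : #|` run x y a| = a.
Proof.
rewrite card_imfset /=; first by rewrite -cardE card_ord.
by move=> i j [] /addrI [] /ord_inj.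
Qed.

(** At level one a gap is a single cell, here the one of rank [y + a]. Taking [b = 0] gives a
    one-run column, so that both shapes of column are treated together. *)
Definition runs (x y : int) (a b : nat) : {fset cell} :=
  run x y a `|` run x (y + a%:Z + 1) b.

Lemma in_runs (x y : int) (a b : nat) (c : cell) :
  (c \in runs x y a b) = (c.1 == x) &&
    ((y <= c.2 < y + a%:Z) || (y + a%:Z < c.2 <= y + a%:Z + b%:Z)).
Proof. by rewrite in_fsetU !in_run; case: (c.1 == x) => //=; lia. Qed.

Lemma runs0 (x y : int) (a : nat) : runs x y a 0 = run x y a.
Proof.
by apply/fsetP => c; rewrite in_runs in_run; case: (c.1 == x) => //=; lia.
Qed.

Lemma card_runs (x y : int) (a b : nat) : #|` runs x y a b| = (a + b)%N.
Proof.
rewrite cardfsU !card_run (_ : _ `&` _ = fset0) ?cardfs0 ?subn0 //.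
apply/fsetP => c; rewrite in_fsetI !in_run in_fset0.
by case: (c.1 == x) => //=; lia.
Qed.

Lemma runs_inj (x y y' : int) (a a' b b' : nat) : (0 < a)%N -> (0 < a')%N ->
  runs x y a b = runs x y' a' b' -> [/\ y = y', a = a' & b = b'].
Proof.
move=> a0 a'0 e.
have h z : ((y <= z < y + a%:Z) || (y + a%:Z < z <= y + a%:Z + b%:Z)) =
    ((y' <= z < y' + a'%:Z) || (y' + a'%:Z < z <= y' + a'%:Z + b'%:Z)).
  by have := congr1 (fun S => (x, z) \in S) e; rewrite /= !in_runs /= eqxx.
have ey : y = y' by have := h y; have := h y'; lia.
subst y'.
have ea : a = a' by have := h (y + a%:Z); have := h (y + a'%:Z); lia.
subst a'; split=> //.
by have := h (y + a%:Z + b%:Z); have := h (y + a%:Z + b'%:Z); lia.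
Qed.

(** Connectedness is stated on plain cells rather than on the finite type of [S], so that paths can
    be carried over to a larger set. *)
Definition linked (S : {fset cell}) (c d : cell) : Prop :=
  exists (hc : c \in S) (hd : d \in S), connect (@adj_in S) [` hc] [` hd].

Lemma share_edge_sym (c d : cell) : share_edge c d = share_edge d c.
Proof.
rewrite /share_edge -(opprB d c); case: (d - c) => u v.
by rewrite !inE /= !xpair_eqE /=; apply/idP/idP; lia.
Qed.

Lemma linked_refl (S : {fset cell}) (c : cell) : c \in S -> linked S c c.
Proof. by move=> hc; exists hc, hc; exact: connect0. Qed.

Lemma linked_trans (S : {fset cell}) (c d e : cell) :
  linked S c d -> linked S d e -> linked S c e.
Proof.
move=> [hc [hd cd]] [hd' [he de]]; exists hc, he.
by rewrite (bool_irrelevance hd' hd) in de; exact: connect_trans de.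
Qed.

Lemma adj_in_sym (S : {fset cell}) : connect_sym (@adj_in S).
Proof. by apply: sym_connect_sym => c d; rewrite /adj_in share_edge_sym. Qed.

Lemma linked_sym (S : {fset cell}) (c d : cell) : linked S c d -> linked S d c.
Proof. by move=> [hc [hd cd]]; exists hd, hc; rewrite adj_in_sym. Qed.

Lemma linked_edge (S : {fset cell}) (c d : cell) :
  c \in S -> d \in S -> share_edge c d -> linked S c d.
Proof. by move=> hc hd cd; exists hc, hd; exact: connect1. Qed.

Lemma linked_sub (S T : {fset cell}) (c d : cell) :
  S `<=` T -> linked S c d -> linked T c d.
Proof.
move=> /fsubsetP ST [hc [hd /connectP[p]]].
elim: p c hc => [|e p IH] c hc /=.
  by move=> _ /(congr1 val) /= ->; exact/linked_refl/ST.
case/andP=> ce pp l; have he := valP e.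
have ed : linked T (val e) d.
  by apply: (IH (val e) he); rewrite (_ : [` he] = e) //; exact: val_inj.
by apply: linked_trans ed; apply: linked_edge ce; exact: ST.
Qed.

Lemma in_component (S : {fset cell}) (c : S) (d : cell) :
  d \in component c <-> linked S (val c) d.
Proof.
split=> [/imfsetP[e /= ce ->]|[hc [hd cd]]].
  exists (valP c), (valP e).
  rewrite (_ : [` valP c] = c); last exact: val_inj.
  by rewrite (_ : [` valP e] = e) //; exact: val_inj.
apply/imfsetP; exists [` hd] => //=.
by rewrite (_ : c = [` hc]) //; exact: val_inj.
Qed.

Lemma componentsP (S K : {fset cell}) :
  K \in components S <->
  exists2 c, c \in S & forall d, d \in K <-> linked S c d.
Proof.
split=> [/imfsetP[c /= _ ->]|[c hc hK]].
  by exists (val c); [exact: valP|move=> d; exact: in_component].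
apply/imfsetP; exists [` hc] => //=.
apply/fsetP => d; apply/idP/idP.
  by move/hK => ?; apply/in_component.
by move/in_component/hK.
Qed.

(** Induction along the path. This bounds a component from above, whereas exhibiting paths bounds it
    from below. *)
Lemma linked_closed (S A : {fset cell}) (c d : cell) : 
  (forall e f, e \in A -> f \in S -> share_edge e f -> f \in A) ->
  c \in A -> linked S c d -> d \in A.
Proof.
move=> clA cA [hc [hd /connectP[p]]].
elim: p c hc cA => [|e p IH] c hc cA /=.
  by move=> _ /(congr1 val) /= ->.
case/andP=> ce pp l; have he := valP e.
apply: (IH (val e) he); first exact: clA ce.
all: by rewrite (_ : [` he] = e) //; exact: val_inj.
Qed.

Lemma run_linked (x y : int) (a : nat) (c d : cell) :
  c \in run x y a -> d \in run x y a -> linked (run x y a) c d.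
Proof.
have H (k : nat) : (k < a)%N -> linked (run x y a) (x, y) (x, y + k%:Z).
  elim: k => [|k IH] ka.
    by rewrite addr0; apply: linked_refl; rewrite in_run /=; lia.
  apply: linked_trans (IH (ltnW ka)) _.
  apply: linked_edge; rewrite ?in_run /= ?eqxx /=; try lia.
  by rewrite /share_edge !inE /= !xpair_eqE /=; lia.
have H' e : e \in run x y a -> linked (run x y a) (x, y) e.
  case: e => u v; rewrite in_run /= => /andP[/eqP-> h].
  have -> : v = y + (`|v - y|%N)%:Z by lia.
  by apply: H; lia.
by move=> /H' hc /H' hd; apply: linked_trans hd; exact: linked_sym.
Qed.

(** Within one stack a cell shares edges only with the ranks just above and below it, so a run whose
    two end neighbours are missing is closed under adjacency. *)
Lemma maximal_run (S : {fset cell}) (x y : int) (a : nat) (c : cell) :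
  (forall d, d \in S -> d.1 = x) -> run x y a `<=` S ->
  (x, y - 1) \notin S -> (x, y + a%:Z) \notin S -> c \in run x y a ->
  forall d, d \in run x y a <-> linked S c d.
Proof.
move=> Sx rS lo hi cr d; split.
  by move=> dr; apply: linked_sub rS _; exact: run_linked.
apply: linked_closed (cr) => -[e1 e2] [f1 f2].
rewrite !in_run /= => /andP[/eqP-> he] fS; have /= fx := Sx _ fS; subst f1.
rewrite eqxx /= /share_edge !inE /= !xpair_eqE /= => H.
have : f2 != y - 1 by apply: contraNneq lo => <-.
have : f2 != y + a%:Z by apply: contraNneq hi => <-.
move: H; lia.
Qed.

(** * Columns *)

(* The cells of the next stack that touch a column [runs x y a b] are those of rank y - 1 to
   y - 2 + width a b. *)
Definition width (a b : nat) : nat := (a + b + 1 + (0 < b))%N.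

(* The column [runs (x + 1) (y + d) a b] may follow a column of the stack x based at y and of
   width w. *)
Definition attach (w : nat) (d : int) (a b : nat) : bool :=
  [&& (0 < a)%N, - a%:Z <= d &
      if b == 0%N then d + 2 <= w%:Z else d + a%:Z + 3 <= w%:Z].

(** A gap of one cell is invisible from the right: the ranks touched by the two runs, y - 1 to y + a
    - 1 and y + a to y + a + b, form a single interval. *)
Lemma run_touch (x y z : int) (a b k : nat) : (0 < a)%N ->
  (exists c e : cell,
     [/\ c \in runs x y a b, e \in run (x + 1) z k & share_edge c e]) <->
  [/\ (0 < k)%N, y <= z + k%:Z & z + 2 <= y + (width a b)%:Z].
Proof.
move=> a0; rewrite /width; split.
  case=> -[c1 c2] [[e1 e2]] []; rewrite in_runs in_run /=.
  move=> /andP[/eqP-> hc] /andP[/eqP-> he].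
  rewrite /share_edge !inE /= !xpair_eqE /= => h.
  by split; lia.
case=> k0 h1 h2.
pose e2 := Num.max z (y - 1).
have he : z <= e2 /\ y - 1 <= e2 /\ (e2 = z \/ e2 = y - 1) by rewrite /e2; lia.
move: e2 he => e2 he.
(* The cell [(x + 1, e2)] touches [(x, e2)] and [(x, e2 + 1)]. The former is in the column unless
   [e2] is the rank just below it or that of the gap, and then the latter is. *)
pose hi := (e2 == y - 1) || (e2 == y + a%:Z).
exists (x, if hi then e2 + 1 else e2), (x + 1, e2); rewrite in_runs in_run /=.
rewrite !eqxx /share_edge !inE /= !xpair_eqE /= /hi; case: ifP => h; split; lia.
Qed.

Lemma components_runs (x y : int) (a b : nat) (K : {fset cell}) :
  (0 < a)%N -> K \in components (runs x y a b) <->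
  K = run x y a \/ (0 < b)%N /\ K = run x (y + a%:Z + 1) b.
Proof.
move=> a0.
have Sx d : d \in runs x y a b -> d.1 = x by rewrite in_runs => /andP[/eqP].
have L1 c : c \in run x y a ->
    forall d, d \in run x y a <-> linked (runs x y a b) c d.
  apply: maximal_run => //; rewrite ?fsubsetUl // in_runs /=; lia.
have L2 c : c \in run x (y + a%:Z + 1) b ->
    forall d, d \in run x (y + a%:Z + 1) b <-> linked (runs x y a b) c d.
  apply: maximal_run => //; rewrite ?fsubsetUr // in_runs /=; lia.
split.
  case/componentsP => c; rewrite in_fsetU => /orP[] cr hK.
    left; apply/fsetP => d; apply/idP/idP.
      by move/hK/(L1 c cr).
    by move/(L1 c cr)/hK.
  right; split; first by move: cr; rewrite in_run; lia.
  apply/fsetP => d; apply/idP/idP.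
    by move/hK/(L2 c cr).
  by move/(L2 c cr)/hK.
case=> [->|[b0 ->]]; apply/componentsP.
  have h : (x, y) \in run x y a by rewrite in_run /=; lia.
  exists (x, y); first by rewrite in_fsetU h.
  exact: L1.
have h : (x, y + a%:Z + 1) \in run x (y + a%:Z + 1) b by rewrite in_run /=; lia.
exists (x, y + a%:Z + 1); first by rewrite in_fsetU h orbT.
exact: L2.
Qed.

Lemma fset_min (f : cell -> int) (S : {fset cell}) : S != fset0 ->
  exists2 c, c \in S & forall d, d \in S -> f c <= f d.
Proof.
case/fset0Pn => c0 c0S.
case: (@arg_minP _ _ S [` c0S] xpredT (fun c : S => f (val c))) => //.
move=> c _ H; exists (val c); first exact: valP.
by move=> d dS; exact: (H [` dS]).
Qed.

Lemma maximal_run_above (S : {fset cell}) (x y : int) : (x, y) \in S ->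
  exists a : nat, [/\ (0 < a)%N, run x y a `<=` S & (x, y + a%:Z) \notin S].
Proof.
move=> yS.
(* Finiteness of [S]: the rank above its topmost cell is missing. *)
have ex : exists k : nat, (x, y + k%:Z) \notin S.
  case: (@arg_maxP _ _ S [` yS] xpredT (fun c : S => (val c).2)) => //.
  move=> c _ H; exists (`|(val c).2 - y|%N).+1.
  apply/negP => h; have := H [` h] isT; have /= := H [` yS] isT.
  lia.
case: (ex_minnP ex) => a ha mina; exists a; split=> //.
  by case: a ha mina => // /negP[]; rewrite addr0.
apply/fsubsetP => -[u v]; rewrite in_run /= => /andP[/eqP-> h].
apply/negPn/negP => H.
have hv : v = y + (`|v - y|%N)%:Z by lia.
by rewrite hv in H; have := mina _ H; lia.
Qed.

Lemma component_from (S : {fset cell}) (x z : int) :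
  (forall d, d \in S -> d.1 = x) -> (x, z) \in S -> (x, z - 1) \notin S ->
  exists b : nat, [/\ (0 < b)%N, run x z b `<=` S, (x, z + b%:Z) \notin S &
                      run x z b \in components S].
Proof.
move=> Sx zS lo; have [b [b0 rS hi]] := maximal_run_above _ _ _ zS.
exists b; split=> //; apply/componentsP; exists (x, z) => //.
by apply: maximal_run => //; rewrite in_run /=; lia.
Qed.

Lemma card_le1 (T : Type) (A : set T) (a b : T) :
  (A #<= `I_1)%card -> A a -> A b -> a = b.
Proof.
move=> /pcard_leP[f] Aa Ab.
have f0 z : A z -> f z = 0%N.
  by move=> Az; have /= := @funS _ _ _ _ f z Az; rewrite ltnS leqn0 => /eqP.
apply: (@inj _ _ _ f); rewrite ?inE; [exact: Aa|exact: Ab|exact: etrans (f0 a Aa) (esym (f0 b Ab))].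
Qed.

Lemma card_le1_sub (T : Type) (A : set T) (a : T) :
  (A `<=` [set a])%classic -> (A #<= `I_1)%card.
Proof.
by move=> s; rewrite -(@card_le_eqr _ _ _ _ _ _ (@card_set1 _ a)); exact: subset_card_le s.
Qed.

Lemma in_fset_neq (S T : {fset cell}) (c : cell) :
  c \in S -> c \notin T -> S != T.
Proof. by move=> cS; apply: contraNneq => <-. Qed.

(** Maximal runs are peeled off from the bottom. The gap condition fixes where the second one
    starts, and the bound on the number of components excludes a third. *)
Lemma column_shape (S : {fset cell}) (x : int) : S != fset0 ->
  (forall d, d \in S -> d.1 = x) -> (#|` components S| <= 2)%N ->
  (forall K L, K \in components S -> L \in components S -> K != L ->
     gap x K L #<= `I_1)%card ->
  exists (y : int) (a b : nat), (0 < a)%N /\ S = runs x y a b.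
Proof.
move=> S0 Sx S2 Sgap.
have [[x0 y] yS ymin] := fset_min snd _ S0.
have /= xx0 := Sx _ yS; subst x0.
have ylo' : (x, y - 1) \notin S.
  by apply/negP => /ymin /=; lia.
have [a [a0 aS ahi aK]] := component_from _ _ _ Sx yS ylo'.
exists y, a.
have [T0|T0] := eqVneq (S `\` run x y a) fset0.
  exists 0%N; split=> //; rewrite runs0; apply/eqP; rewrite eqEfsubset aS andbT.
  by rewrite -fsetD_eq0 T0.
have [[x0 z]] := fset_min snd _ T0.
rewrite in_fsetD => /andP[zr zS] zmin.
have /= xx0 := Sx _ zS; subst x0.
have zlo : y + a%:Z < z.
  have := ymin _ zS; move: zr; rewrite in_run /=.
  have : z != y + a%:Z by apply: contraNneq ahi => <-.
  by clear; lia.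
have zlo' : (x, z - 1) \notin S.
  apply/negP => h; have := zmin (x, z - 1).
  by rewrite in_fsetD h in_run /=; move: zlo; clear; lia.
have [b [b0 bS bhi bK]] := component_from _ _ _ Sx zS zlo'.
have zE : z = y + a%:Z + 1.
  have ab : run x y a != run x z b.
    apply: (@in_fset_neq _ _ (x, y)); rewrite in_run /=.
      by move: a0; clear; lia.
    by move: zlo; clear; lia.
  (* The lowest and highest cells of the gap belong to a set of at most one cell, so they
     coincide. *)
  have := card_le1 _ _ (x, y + a%:Z) (x, z - 1) (Sgap _ _ aK bK ab).
  have G u : y + a%:Z <= u -> u < z -> gap x (run x y a) (run x z b) (x, u).
    move=> h1 h2; split=> // -[e1 e2]; rewrite in_run /=.
      by move: h1; clear; lia.
    by move: h2; clear; lia.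
  have G1 : gap x (run x y a) (run x z b) (x, y + a%:Z).
    by apply: G; move: zlo; clear; lia.
  have G2 : gap x (run x y a) (run x z b) (x, z - 1).
    by apply: G; move: zlo; clear; lia.
  by move=> /(_ G1 G2) []; clear; lia.
subst z; exists b; split=> //.
have rS : runs x y a b `<=` S by rewrite fsubUset aS.
have [U0|U0] := eqVneq (S `\` runs x y a b) fset0.
  by apply/eqP; rewrite eqEfsubset rS andbT -fsetD_eq0 U0.
have [[x0 u]] := fset_min snd _ U0.
rewrite in_fsetD => /andP[ur uS] umin.
have /= xx0 := Sx _ uS; subst x0.
have ulo : y + a%:Z + b%:Z + 1 < u.
  have := ymin _ uS; move: ur; rewrite in_runs /=.
  have : u != y + a%:Z by apply: contraNneq ahi => <-.
  have : u != y + a%:Z + 1 + b%:Z by apply: contraNneq bhi => <-.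
  by clear; lia.
have ulo' : (x, u - 1) \notin S.
  apply/negP => h; have := umin (x, u - 1).
  by rewrite in_fsetD h in_runs /=; move: ulo; clear; lia.
have [c [c0 cS chi cK]] := component_from _ _ _ Sx uS ulo'.
(* A cell left over would start a third run, hence a third component. *)
have : [fset run x y a; run x (y + a%:Z + 1) b; run x u c] `<=` components S.
  by apply/fsubsetP => K; rewrite !inE => /orP[/orP[]|] /eqP ->.
move/fsubset_leq_card; rewrite fsetUC cardfsU1 cardfs2 !inE.
have ab : run x y a != run x (y + a%:Z + 1) b.
  by apply: (@in_fset_neq _ _ (x, y)); rewrite in_run /=; move: a0; clear; lia.
have ca : run x u c != run x y a.
  apply: (@in_fset_neq _ _ (x, u)); rewrite in_run /=; move: c0 ulo; clear; lia.
have cb : run x u c != run x (y + a%:Z + 1) b.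
  apply: (@in_fset_neq _ _ (x, u)); rewrite in_run /=; move: c0 ulo; clear; lia.
rewrite (negPf ca) (negPf cb) ab /=.
by move=> h; have := leq_trans h S2.
Qed.

Lemma card_components_runs (x y : int) (a b : nat) : (0 < a)%N ->
  #|` components (runs x y a b)| = (1 + (0 < b))%N.
Proof.
move=> a0; have [->|b0] := posnP b.
  rewrite (_ : components _ = [fset run x y a]) ?cardfs1 //.
  apply/fsetP => K; rewrite inE; apply/idP/eqP.
    by case/(components_runs x y a 0 K a0) => [->|[]].
  by move=> ->; apply/components_runs => //; left.
rewrite (_ : components _ = [fset run x y a; run x (y + a%:Z + 1) b]).
  rewrite cardfs2 (@in_fset_neq _ _ (x, y)) //; rewrite in_run /=.
    by move: a0; clear; lia.
  by clear; lia.
apply/fsetP => K; rewrite !inE; apply/idP/orP.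
  by case/(components_runs x y a b K a0) => [->|[_ ->]]; [left|right].
by move=> h; apply/components_runs => //; case: h => /eqP ->; [left|right].
Qed.

Lemma gap_runs (x y : int) (a b : nat) (K L : {fset cell}) : (0 < a)%N ->
  K \in components (runs x y a b) -> L \in components (runs x y a b) ->
  K != L -> (gap x K L #<= `I_1)%card.
Proof.
move=> a0 /(components_runs _ _ _ _ _ a0) hK /(components_runs _ _ _ _ _ a0) hL.
move=> KL; apply: (@card_le1_sub _ _ (x, y + a%:Z)) => -[u v] [/= -> h1 h2].
have b0 : (0 < b)%N.
  by case: hK hL KL => [->|[]//] [->|[]//]; rewrite eqxx.
congr pair.
case: hK hL KL h1 h2 => [->|[_ ->]] [->|[_ ->]]; rewrite ?eqxx // => _ h1 h2.
  have := h1 (x, y + a%:Z - 1); have := h2 (x, y + a%:Z + 1).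
  by rewrite !in_run /=; lia.
have := h1 (x, y + a%:Z + 1); have := h2 (x, y).
by rewrite !in_run /=; lia.
Qed.

(** Each run of the right column must meet the interval of touched ranks. For two runs it suffices
    that the lower one is not entirely below this interval and the upper one not entirely above it,
    hence the two inequalities in [attach]. *)
Lemma attachP (x y d : int) (a b a' b' : nat) : (0 < a)%N -> (0 < a')%N ->
  attach (width a b) d a' b' <->
  (forall K, K \in components (runs (x + 1) (y + d) a' b') ->
     exists c e : cell, [/\ c \in runs x y a b, e \in K & share_edge c e]).
Proof.
move=> a0 a'0; split.
  rewrite /attach => /and3P[_ h1 h2] K /(components_runs _ _ _ _ _ a'0).
  by case=> [->|[b0 ->]]; apply/run_touch => //; move: h2; case: eqP => ?; split; lia.
move=> h.
have /(run_touch _ _ _ _ _ _ a0)[_ h1 h2] :=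
  h _ (proj2 (components_runs _ _ _ _ _ a'0) (or_introl erefl)).
rewrite /attach a'0 /=; case: eqP => [|/eqP] b'0; first by lia.
have b'p : (0 < b')%N by rewrite lt0n.
have /(run_touch _ _ _ _ _ _ a0)[_ h3 h4] :=
  h _ (proj2 (components_runs _ _ _ _ _ a'0) (or_intror (conj b'p erefl))).
by lia.
Qed.

(** * Coding polyominoes by their columns *)

(* A column (d, a, b) consists of a lower run of a > 0 cells and, above a gap of one cell, an upper
   run of b cells (b = 0 for a one-run column); d is the height of its lowest cell relative to that
   of the previous column. *)
Fixpoint valid (w : nat) (s : seq (int * nat * nat)) : bool :=
  if s is (d, a, b) :: s' then attach w d a b && valid (width a b) s' else true.

(** Here [x] is the stack of the first column of [s], whereas [y] is the base of the column before
    it. *)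
Fixpoint cells (x y : int) (s : seq (int * nat * nat)) : {fset cell} :=
  if s is (d, a, b) :: s' then runs x (y + d) a b `|` cells (x + 1) (y + d) s'
  else fset0.

Fixpoint area (s : seq (int * nat * nat)) : nat :=
  if s is (d, a, b) :: s' then (a + b + area s')%N else 0%N.

Lemma valid_a_gt0 (w : nat) (d : int) (a b : nat) s :
  valid w ((d, a, b) :: s) -> (0 < a)%N.
Proof. by rewrite /= /attach => /andP[/and3P[]]. Qed.

Lemma in_cells (x y d : int) (a b : nat) s (c : cell) :
  (c \in cells x y ((d, a, b) :: s)) =
  (c \in runs x (y + d) a b) || (c \in cells (x + 1) (y + d) s).
Proof. exact: in_fsetU. Qed.

Lemma cells_ge (x y : int) s (c : cell) : c \in cells x y s -> x <= c.1.
Proof.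
elim: s x y => [|[[d a] b] s IH] x y; first by rewrite in_fset0.
rewrite in_fsetU in_runs => /orP[/andP[/eqP->]//|/IH]; lia.
Qed.

Lemma in_column (P : {fset cell}) (i : int) (c : cell) :
  (c \in column P i) = (c \in P) && (c.1 == i).
Proof. by rewrite !inE. Qed.

Lemma column_nil (x y i : int) : column (cells x y [::]) i = fset0.
Proof. by apply/fsetP => c; rewrite in_column in_fset0. Qed.

Lemma column_cells_head (x y d : int) (a b : nat) s :
  column (cells x y ((d, a, b) :: s)) x = runs x (y + d) a b.
Proof.
apply/fsetP => c; rewrite in_column in_fsetU in_runs.
case: (c.1 =P x) => cx; rewrite ?andbF ?andbT //=.
have -> : (c \in cells (x + 1) (y + d) s) = false.
  by apply/negP => /cells_ge; rewrite cx; lia.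
by rewrite orbF.
Qed.

Lemma column_cells_behead (x y d : int) (a b : nat) s (i : int) : i != x ->
  column (cells x y ((d, a, b) :: s)) i = column (cells (x + 1) (y + d) s) i.
Proof.
move=> ix; apply/fsetP => c; rewrite !in_column in_fsetU in_runs.
case: (c.1 =P i) => ci; rewrite ?andbF ?andbT //=.
by rewrite ci (negPf ix).
Qed.

Lemma runs_neq0 (x y : int) (a b : nat) : (0 < a)%N -> runs x y a b != fset0.
Proof. by move=> a0; apply/fset0Pn; exists (x, y); rewrite in_runs /=; lia. Qed.

Lemma column_cells_lt (x y : int) s (i : int) : i < x ->
  column (cells x y s) i = fset0.
Proof.
move=> ix; apply/fsetP => c; rewrite in_column in_fset0; apply/negP.
by case/andP => /cells_ge h /eqP ci; lia.
Qed.

Lemma column_cells (w : nat) (x y : int) s (i : int) : valid w s ->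
  column (cells x y s) i = fset0 \/
  exists (z : int) (a b : nat),
    (0 < a)%N /\ column (cells x y s) i = runs i z a b.
Proof.
elim: s w x y => [|[[d a] b] s IH] w x y.
  by move=> _; left; apply/fsetP => c; rewrite in_column in_fset0.
move=> v; have a0 := valid_a_gt0 _ _ _ _ _ v.
have [->|ix] := eqVneq i x.
  by right; rewrite column_cells_head; exists (y + d), a, b.
by rewrite column_cells_behead //; move: v => /andP[_ /IH].
Qed.

Lemma column_cells_gap (w : nat) (x y : int) s (i k : int) : valid w s ->
  x <= i -> i < k -> column (cells x y s) i = fset0 ->
  column (cells x y s) k = fset0.
Proof.
elim: s w x y => [|[[d a] b] s IH] w x y.
  by move=> _ _ _ _; apply/fsetP => c; rewrite in_column in_fset0.
move=> v xi ik; have a0 := valid_a_gt0 _ _ _ _ _ v.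
have [->|ix] := eqVneq i x.
  by rewrite column_cells_head => /eqP; rewrite (negPf (runs_neq0 _ _ _ _ a0)).
have kx : k != x by move: ik xi; clear; lia.
rewrite !column_cells_behead //; move: v => /andP[_ v].
by apply: (IH _ _ _ v) => //; move: xi ix; clear; lia.
Qed.

Lemma column_cells_attach (w : nat) (x y : int) s (i : int) : valid w s ->
  x <= i -> column (cells x y s) (i + 1) != fset0 ->
  exists (z d : int) (a b a' b' : nat),
    [/\ (0 < a)%N /\ (0 < a')%N, column (cells x y s) i = runs i z a b,
        column (cells x y s) (i + 1) = runs (i + 1) (z + d) a' b' &
        attach (width a b) d a' b'].
Proof.
elim: s w x y => [|[[d a] b] s IH] w x y.
  by move=> _ _ /fset0Pn[c]; rewrite in_column in_fset0.
move=> v xi; have a0 := valid_a_gt0 _ _ _ _ _ v; move: v => /andP[_ v].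
have ix1 : i + 1 != x by move: xi; clear; lia.
rewrite [column _ (i + 1)]column_cells_behead //.
have [ix|ix] := eqVneq i x; last first.
  move=> h; rewrite column_cells_behead //; apply: (IH _ _ _ v) => //.
  by move: xi ix; clear; lia.
subst i; rewrite column_cells_head.
case: s v {IH} => [_ /fset0Pn[c]|[[d' a'] b'] s v].
  by rewrite in_column in_fset0.
have a'0 := valid_a_gt0 _ _ _ _ _ v; move: v => /andP[v _] _.
by rewrite column_cells_head; exists (y + d), d', a, b, a', b'.
Qed.

Lemma card_cells (x y : int) s : #|` cells x y s| = area s.
Proof.
elim: s x y => [|[[d a] b] s IH] x y; first by rewrite cardfs0.
rewrite /= cardfsU card_runs IH (_ : _ `&` _ = fset0) ?cardfs0 ?subn0 //.
apply/fsetP => c; rewrite in_fsetI in_runs in_fset0; apply/negP.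
by case/andP => /andP[/eqP cx _] /cells_ge; rewrite cx; clear; lia.
Qed.

Lemma in_translate (v : cell) (P : {fset cell}) (c : cell) :
  (c \in translate v P) = ((c.1 - v.1, c.2 - v.2) \in P).
Proof.
apply/imfsetP/idP => [[e /= eP ->]|h].
  by rewrite (_ : (_, _) = e) //; case: e {eP} => e1 e2 /=; congr pair; lia.
by exists (c.1 - v.1, c.2 - v.2) => //; case: c {h} => c1 c2; congr pair => /=; lia.
Qed.

Lemma translate_cells (x y u v : int) s :
  translate (u, v) (cells x y s) = cells (u + x) (v + y) s.
Proof.
apply/fsetP => c; rewrite in_translate.
elim: s x y => [|[[d a] b] s IH] x y; first by rewrite !in_fset0.
rewrite /= in_fsetU in_runs IH in_fsetU in_runs /= -!addrA; congr orb.
by clear; lia.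
Qed.

(** The column in the stack [x] determines the first triple by [runs_inj]. The other cells lie
    strictly to its right, so the remaining sets agree and the induction applies. *)
Lemma cells_inj (w w' : nat) (x y : int) s s' : valid w s -> valid w' s' ->
  cells x y s = cells x y s' -> s = s'.
Proof.
elim: s s' w w' x y => [|[[d a] b] s IH] [|[[d' a'] b'] s'] w w' x y //.
- move=> _ v h; have a0 := valid_a_gt0 _ _ _ _ _ v.
  have := runs_neq0 x (y + d') a' b' a0.
  by rewrite -(column_cells_head _ _ _ _ _ s') -h column_nil eqxx.
- move=> v _ h; have a0 := valid_a_gt0 _ _ _ _ _ v.
  have := runs_neq0 x (y + d) a b a0.
  by rewrite -(column_cells_head _ _ _ _ _ s) h column_nil eqxx.
move=> v v' h; have a0 := valid_a_gt0 _ _ _ _ _ v.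
have a'0 := valid_a_gt0 _ _ _ _ _ v'.
have := congr1 (fun P => column P x) h.
rewrite /= -/(cells x y ((d, a, b) :: s)) -/(cells x y ((d', a', b') :: s')).
rewrite !column_cells_head => /(runs_inj _ _ _ _ _ _ _ a0 a'0)[/addrI ed ea eb].
subst d' a' b'; congr cons.
move: v v' => /andP[_ v] /andP[_ v'].
apply: (IH _ _ _ (x + 1) (y + d) v v').
apply/fsetP => c; have := congr1 (fun P => c \in P) h.
rewrite /= -/(cells x y ((d, a, b) :: s)) -/(cells x y ((d, a, b) :: s')).
rewrite !in_cells in_runs; case: (c.1 =P x) => //= cx _.
by apply/idP/idP => /cells_ge; rewrite cx; clear; lia.
Qed.

Lemma first_cells_inj (x x' y y' : int) (a a' : nat) s s' :
  (0 < a)%N -> (0 < a')%N -> valid (width a 0) s -> valid (width a' 0) s' ->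
  cells x y ((0, a, 0%N) :: s) = cells x' y' ((0, a', 0%N) :: s') ->
  a = a' /\ s = s'.
Proof.
move=> a0 a'0 v v' h.
have h1 : (x, y) \in cells x y ((0, a, 0%N) :: s).
  by rewrite in_fsetU in_runs /=; move: a0; clear; lia.
have h2 : (x', y') \in cells x' y' ((0, a', 0%N) :: s').
  by rewrite in_fsetU in_runs /=; move: a'0; clear; lia.
have xx : x = x'.
  rewrite h in h1; rewrite -h in h2; move/cells_ge: h1; move/cells_ge: h2 => /=.
  by clear; lia.
subst x'.
have := congr1 (fun P => column P x) h; rewrite /= -/(cells x y ((0, a, 0%N) :: s)).
rewrite -/(cells x y' ((0, a', 0%N) :: s')) !column_cells_head.
move=> /(runs_inj _ _ _ _ _ _ _ a0 a'0)[ey ea _].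
have yy : y = y' by move: ey; clear; lia.
subst y' a'; split=> //.
have [] // : (0, a, 0%N) :: s = (0, a, 0%N) :: s'.
(* A fictitious preceding column of width [a + 2] lets the first column be attached at relative
   height 0. *)
apply: (@cells_inj (a + 2) (a + 2) x y) h; rewrite /= /attach a0.
  by rewrite v andbT /=; clear; lia.
by rewrite v' andbT /=; clear; lia.
Qed.

Lemma linked_connect (S : {fset cell}) (c d : S) :
  linked S (val c) (val d) -> connect (@adj_in S) c d.
Proof. by move/in_component => /imfsetP[e /= ce /val_inj ->]. Qed.

Lemma runs_linked_step (x y d : int) (a b a' b' : nat) (c : cell) :
  (0 < a)%N -> attach (width a b) d a' b' ->
  c \in runs (x + 1) (y + d) a' b' ->
  exists2 e, e \in runs x y a b &
    linked (runs x y a b `|` runs (x + 1) (y + d) a' b') c e.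
Proof.
move=> a0 at'; have a'0 : (0 < a')%N by move: at' => /and3P[].
move=> cr; set S := _ `|` _.
have [K KK cK] : exists2 K, K \in components (runs (x + 1) (y + d) a' b') & c \in K.
  move: cr; rewrite in_fsetU => /orP[] cr.
    exists (run (x + 1) (y + d) a') => //.
    by apply/components_runs => //; left.
  exists (run (x + 1) (y + d + a'%:Z + 1) b') => //.
  apply/components_runs => //; right; split=> //.
  by move: cr; rewrite in_run; clear; lia.
have [e [f [er fK ef]]] := proj1 (attachP x y d a b a' b' a0 a'0) at' K KK.
have [g gS gK] := proj1 (componentsP _ _) KK.
have KS h : h \in K -> linked S g h.
  move=> /gK; apply: linked_sub; exact: fsubsetUr.
exists e => //.
apply: linked_trans (linked_sym _ _ _ (KS _ cK)) _.
apply: linked_trans (KS _ fK) _.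
apply: linked_edge; last by rewrite share_edge_sym.
  by have [_ [? _]] := KS _ fK.
by rewrite in_fsetU er.
Qed.

(** A two-run column is not connected by itself, so a cell is only linked to some cell of the
    preceding column. Going left, it ends in the first column of the polyomino, which is one run. *)
Lemma cells_linked (x y : int) (a b : nat) s (c : cell) : (0 < a)%N ->
  valid (width a b) s -> c \in cells (x + 1) y s ->
  exists2 e, e \in runs x y a b &
    linked (runs x y a b `|` cells (x + 1) y s) c e.
Proof.
elim: s x y a b => [|[[d a'] b'] s IH] x y a b a0; first by rewrite in_fset0.
move=> v; have a'0 := valid_a_gt0 _ _ _ _ _ v; move: v => /andP[at' v].
have S1 : runs x y a b `|` runs (x + 1) (y + d) a' b' `<=`
    runs x y a b `|` cells (x + 1) y ((d, a', b') :: s).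
  by apply: fsetUS; exact: fsubsetUl.
have step f : f \in runs (x + 1) (y + d) a' b' -> exists2 e, e \in runs x y a b &
    linked (runs x y a b `|` cells (x + 1) y ((d, a', b') :: s)) f e.
  move=> fr; have [e er fe] := runs_linked_step _ _ _ _ _ _ _ _ a0 at' fr.
  by exists e => //; exact: linked_sub S1 fe.
rewrite in_cells => /orP[/step//|cs].
have [f fr cf] := IH _ _ _ _ a'0 v cs.
have [e er fe] := step _ fr; exists e => //.
by apply: linked_trans fe; apply: linked_sub cf; exact: fsubsetUr.
Qed.

Lemma polyomino_cells (x y : int) (a : nat) s : (0 < a)%N ->
  valid (width a 0) s -> polyomino (cells x y ((0, a, 0%N) :: s)).
Proof.
move=> a0 v; set P := cells _ _ _.
have PE : P = run x y a `|` cells (x + 1) y s.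
  by rewrite /P /= runs0 addr0.
have rP : run x y a `<=` P by rewrite PE fsubsetUl.
have xyr : (x, y) \in run x y a by rewrite in_run /=; move: a0; clear; lia.
have H c : c \in P -> linked P c (x, y).
  have H1 e : e \in run x y a -> linked P e (x, y).
    by move=> er; apply: linked_sub rP _; exact: run_linked.
  rewrite PE in_fsetU -PE => /orP[/H1//|cs].
  have [e er ce] := cells_linked _ _ _ _ _ _ a0 v cs.
  rewrite runs0 in er; apply: linked_trans (H1 _ er).
  by move: ce; rewrite runs0 -PE.
split; first by apply/fset0Pn; exists (x, y); exact: (fsubsetP rP).
move=> c d; apply: linked_connect; apply: linked_trans (H _ (valP c)) _.
exact/linked_sym/H/valP.
Qed.

Lemma cheesy_cells (x y : int) (a : nat) s : (0 < a)%N ->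
  valid (width a 0) s -> cheesy 1 (cells x y ((0, a, 0%N) :: s)).
Proof.
move=> a0 v; set P := cells _ _ _.
have vs : valid (a + 2) ((0, a, 0%N) :: s).
  by rewrite /= v andbT /attach a0 /=; clear; lia.
have comp0 : components fset0 = fset0.
  apply/fsetP => K; rewrite in_fset0; apply/negP => /componentsP[c].
  by rewrite in_fset0.
have first_colx i : column P i != fset0 -> x <= i.
  by apply: contraNle => /column_cells_lt ->.
split.
- exact: polyomino_cells.
- split=> [i [i0 ilt]|i j [ij ni nj nk] K].
    have -> : i = x.
      apply/eqP; rewrite eq_le first_colx // andbT leNgt; apply/negP => /ilt.
      by rewrite column_cells_head => /eqP; rewrite (negPf (runs_neq0 _ _ _ _ a0)).
    by rewrite column_cells_head card_components_runs.
  (* If [j] exceeded [i + 1], the column [i + 1] would be empty, and then so would every later one,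
     including [j]. *)
  have jE : j = i + 1.
    apply/eqP; rewrite eq_le [_ <= j]lezD1 ij andbT leNgt; apply/negP => ij1.
    case/negP: nj; apply/eqP.
    apply: (column_cells_gap _ _ _ _ (i + 1) _ vs) => //.
      by move: (first_colx _ ni); clear; lia.
    by apply: nk => //; clear; lia.
  rewrite jE in nj *.
  have [z [d [b [c [b' [c' [[b0 b'0] -> -> at']]]]]]] :=
    column_cells_attach _ _ _ _ _ vs (first_colx _ ni) nj.
  exact: (proj1 (attachP _ _ _ _ _ _ _ b0 b'0) at').
- move=> i; case: (column_cells _ x y _ i vs) => [->|[z [b [c [b0 ->]]]]].
    by rewrite comp0 cardfs0.
  by rewrite card_components_runs //; case: (0 < c)%N.
move=> i K L; case: (column_cells _ x y _ i vs) => [->|[z [b [c [b0 ->]]]]].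
  by rewrite comp0 in_fset0.
exact: gap_runs.
Qed.

(** Induction on a bound for the number of cells to the right of the stack [i]. The next nonempty
    column shares an edge with column [i], so it lies in the stack [i + 1]; [column_shape] and
    [attachP] then turn it into a triple. *)
Lemma column_tail (P : {fset cell}) (m : nat) (i y : int) (a b : nat) :
  cheesy 1 P -> (#|` [fset c in P | (i < c.1)%R]| <= m)%N ->
  (0 < a)%N -> column P i = runs i y a b ->
  exists2 s, valid (width a b) s &
    [fset c in P | (i < c.1)%R] = cells (i + 1) y s.
Proof.
move=> cP; have [_ [_ adjP] compP gapP] := cP.
elim: m i y a b => [|m IH] i y a b hm a0 Pi.
  exists [::] => //; apply/eqP; rewrite -cardfs_eq0; lia.
have [T0|T0] := eqVneq [fset c in P | (i < c.1)%R] fset0; first by exists [::].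
have [e eT emin] := fset_min fst _ T0.
have [eP ie] : e \in P /\ i < e.1 by move: eT; rewrite !inE => /andP[].
have adj : adjacent_columns P i e.1.
  split=> //.
  - by rewrite Pi runs_neq0.
  - by apply/fset0Pn; exists e; rewrite in_column eP /=.
  move=> k ik ke; apply/fsetP => c; rewrite in_column in_fset0.
  apply/negP => /andP[cP' /eqP ck].
  by have := emin c; rewrite !inE cP' ck ik leNgt ke => /(_ isT).
have colin k (K : {fset cell}) c : K \in components (column P k) -> c \in K ->
    c \in column P k.
  by case/componentsP => f fk hK /hK[fk' [ck _]].
have ecol : e \in column P e.1 by rewrite in_column eP /=.
have eE : e.1 = i + 1.
  have Kc : component [` ecol] \in components (column P e.1).
    by apply/imfsetP; exists [` ecol].
  have [[f1 f2] [[g1 g2] [fi /(colin _ _ _ Kc)]]] := adjP _ _ adj _ Kc.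
  move: fi; rewrite !in_column /= => /andP[_ /eqP ->] /andP[_ /eqP ->].
  rewrite /share_edge !inE /= !xpair_eqE /=; move: ie.
  by move: (e.1 : int) => k; clear; lia.
have [z [a' [b' [a'0 Pe]]]] : exists z a' b', (0 < a')%N /\ column P (i + 1) = runs (i + 1) z a' b'.
  apply: column_shape.
  - by apply/fset0Pn; exists e; rewrite -eE.
  - by move=> c; rewrite in_column => /andP[_ /eqP].
  - exact: compP.
  - exact: gapP.
have zE : z = y + (z - y) by clear; lia.
have at' : attach (width a b) (z - y) a' b'.
  apply/(attachP i y) => // K; rewrite -zE -Pe -Pi => KK.
  by rewrite eE in adj; exact: (adjP _ _ adj).
have TE : [fset c in P | (i < c.1)%R] =
    column P (i + 1) `|` [fset c in P | (i + 1 < c.1)%R].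
  apply/fsetP => c; rewrite in_fsetU in_column !inE /=.
  by case: (c \in P) => //=; clear; lia.
have [|s vs sE] := IH (i + 1) z a' b' _ a'0 Pe.
  rewrite -ltnS; apply: leq_trans hm; apply: fproper_ltn_card.
  rewrite fproperE [X in _ `<=` X]TE fsubsetUr /=.
  by apply/negP => /fsubsetP/(_ _ eT); rewrite !inE eE ltxx andbF.
exists ((z - y, a', b') :: s); first by rewrite /= at'.
by rewrite TE sE Pe /= -zE.
Qed.

Lemma cheesyP (P : {fset cell}) : cheesy 1 P ->
  exists (x y : int) (a : nat) s,
    [/\ (0 < a)%N, valid (width a 0) s & P = cells x y ((0, a, 0%N) :: s)].
Proof.
move=> cP; have [[P0 _] [firstP _] compP gapP] := cP.
have [e eP emin] := fset_min fst _ P0.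
have col0 : column P e.1 != fset0.
  by apply/fset0Pn; exists e; rewrite in_column eP /=.
have comp1 : #|` components (column P e.1)| = 1%N.
  apply: firstP; split=> // k ke; apply/fsetP => c; rewrite in_column in_fset0.
  apply/negP => /andP[cP' /eqP ck]; have := emin _ cP'.
  by rewrite ck leNgt ke.
have [y [a [b [a0 PE]]]] : exists y a b, (0 < a)%N /\ column P e.1 = runs e.1 y a b.
  apply: column_shape => //; last exact: gapP.
  by move=> c; rewrite in_column => /andP[_ /eqP].
have b0 : b = 0%N.
  by move: comp1; rewrite PE card_components_runs //; case: b {PE}.
subst b.
have [s vs sE] := column_tail _ _ _ _ _ _ cP (leqnn _) a0 PE.
exists e.1, y, a, s; split=> //; rewrite /= addr0 -PE -sE.
apply/fsetP => c; rewrite in_fsetU in_column !inE /=.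
case cP' : (c \in P) => //=; have := emin _ cP'; clear; lia.
Qed.

(** * Enumeration *)

(** The parameter [t] is [d + a], which [attach] makes nonnegative. Its upper bound leaves w + j - 1
    values for one run, and w - 2 for each splitting of [j] into two runs. *)
Definition columns_of_size (w j : nat) : seq (int * nat * nat) :=
  [seq (t%:Z - j%:Z, j, 0%N) | t <- iota 0 (w + j - 1)] ++
  [seq (t%:Z - a%:Z, a, (j - a)%N) | a <- iota 1 (j - 1), t <- iota 0 (w - 2)].

Definition columns (w n : nat) : seq (int * nat * nat) :=
  [seq c | j <- iota 1 n, c <- columns_of_size w j].

(* The fuel k bounds the number of columns, so that n <= k is enough. *)
Fixpoint codes (k w n : nat) : seq (seq (int * nat * nat)) :=
  if n == 0%N then [:: [::]] else
  if k is k'.+1 then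
    [seq c :: s | c <- columns w n,
                  s <- codes k' (width c.1.2 c.2) (n - (c.1.2 + c.2))]
  else [::].

Lemma columns_of_sizeP (w j : nat) (d : int) (a b : nat) : (0 < j)%N ->
  ((d, a, b) \in columns_of_size w j) = attach w d a b && (a + b == j)%N.
Proof.
move=> j0; rewrite mem_cat; apply/orP/andP.
  case=> [/mapP[t ht [-> -> ->]]|/allpairsP[[a' t] /= [ha ht [-> -> ->]]]].
    move: ht; rewrite mem_iota /attach /= => ht.
    by split; last apply/eqP; move: ht j0; clear; lia.
  move: ha ht; rewrite !mem_iota /attach => ha ht.
  have -> : (j - a' == 0)%N = false by move: ha; clear; lia.
  by split; last apply/eqP; move: ha ht j0; clear; lia.
rewrite /attach => -[/and3P[a0 h1 h2] /eqP jE].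
case: eqP h2 => [b0|/eqP b0] h2; [left|right].
  apply/mapP; exists `|(d + a%:Z)%R|%N.
    by rewrite mem_iota; move: jE b0 a0 h1 h2; clear; lia.
  congr (_, _, _); move: jE b0 h1; clear; lia.
apply/allpairsP; exists (a, `|(d + a%:Z)%R|%N) => /=; split.
- by rewrite mem_iota; move: jE b0 a0; clear; lia.
- by rewrite mem_iota; move: h1 h2; clear; lia.
congr (_, _, _); move: jE h1; clear; lia.
Qed.

Lemma columnsP (w n : nat) (d : int) (a b : nat) :
  ((d, a, b) \in columns w n) = attach w d a b && (a + b <= n)%N.
Proof.
apply/allpairsPdep/andP.
  case=> j [c [hj hc cE]]; move: hj hc; rewrite mem_iota -cE => hj.
  rewrite columns_of_sizeP; last by move: hj; clear; lia.
  by case/andP => -> /eqP ->; split=> //; move: hj; clear; lia.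
case=> at' h; have a0 : (0 < a)%N by case/and3P: at'.
exists (a + b)%N, (d, a, b); split=> //.
  by rewrite mem_iota; move: a0 h; clear; lia.
by rewrite columns_of_sizeP ?at' ?eqxx // addn_gt0 a0.
Qed.

Lemma uniq_columns (w n : nat) : uniq (columns w n).
Proof.
apply: allpairs_uniq_dep; first exact: iota_uniq.
  move=> j; rewrite mem_iota => hj; rewrite cat_uniq; apply/and3P; split.
  - rewrite map_inj_uniq ?iota_uniq // => t t' [] /addIr.
    by clear; lia.
  - apply/hasP => -[c /allpairsP[[a t] /= [ha ht ->]] /mapP[t' _ [_ ja _]]].
    by move: ha; rewrite mem_iota -ja; move: hj; clear; lia.
  apply: allpairs_uniq; rewrite ?iota_uniq // => -[a t] [a' t'] _ _ /= [e aa _].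
  by subst a'; congr pair; move: e; clear; lia.
move=> [j [[d a] b]] [j' [[d' a'] b']] /allpairsPdep[i [c [hi hc [-> cE]]]].
move=> /allpairsPdep[i' [c' [hi' hc' [-> cE']]]] /= [dd aa bb].
move: hc hc'; rewrite -cE -cE' -dd -aa -bb !mem_iota in hi hi' *.
rewrite !columns_of_sizeP; [|by move: hi'; clear; lia|by move: hi; clear; lia].
by move=> /andP[_ /eqP <-] /andP[_ /eqP <-].
Qed.

(** Every column has a nonempty lower run, so the remaining area drops by at least one for each unit
    of fuel. *)
Lemma codesP (k w n : nat) s : (n <= k)%N ->
  (s \in codes k w n) = valid w s && (area s == n).
Proof.
elim: k w n s => [|k IH] w n s nk.
  move: nk; rewrite leqn0 => /eqP -> /=; rewrite inE.
  case: s => [|[[d a] b] s] //=; symmetry; apply/negP => /andP[/andP[]].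
  by rewrite /attach => /and3P[]; clear; lia.
rewrite /=; have [->|n0] := eqVneq n 0%N.
  rewrite inE; case: s => [|[[d a] b] s] //=; symmetry; apply/negP.
  by case/andP => /andP[]; rewrite /attach => /and3P[]; clear; lia.
apply/allpairsPdep/andP.
  case=> -[[d a] b] [s' [/=]]; rewrite columnsP => /andP[at' h] hs ->.
  have a0 : (0 < a)%N by case/and3P: at'.
  move: hs; rewrite IH; last by move: nk a0; clear; lia.
  case/andP=> v /eqP ar; rewrite /= at' v ar; split=> //; apply/eqP.
  by move: h; clear; lia.
case: s => [|[[d a] b] s] /=; first by case=> _ /eqP e; rewrite -e in n0.
case=> /andP[at' v] /eqP e; have a0 : (0 < a)%N by case/and3P: at'.
exists (d, a, b), s; split=> //=.
  by rewrite columnsP at' -e leq_addr.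
rewrite IH; last by move: nk a0; clear; lia.
by rewrite v -e addKn eqxx.
Qed.

Lemma uniq_codes (k w n : nat) : uniq (codes k w n).
Proof.
elim: k w n => [|k IH] w n /=; first by case: (n == 0%N).
case: (n == 0%N) => //; apply: allpairs_uniq_dep.
- exact: uniq_columns.
- by move=> c _; exact: IH.
by move=> [c s] [c' s'] _ _ /= [-> ->].
Qed.

(** What follows a column depends on it only through its width, which is j + 1 for one run and j + 2
    for two, however the [j] cells are split. *)
Lemma size_codes (k w n : nat) : (0 < n)%N ->
  size (codes k.+1 w n) =
  (\sum_(j <- iota 1 n) ((w + j - 1) * size (codes k (j + 1) (n - j)) +
     (j - 1) * (w - 2) * size (codes k (j + 2) (n - j))))%N.
Proof.
move=> n0 /=; rewrite -[n == 0%N]negbK -lt0n n0 /= size_allpairs_dep sumnE big_map.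
rewrite big_allpairs_dep; apply: eq_big_seq => j; rewrite mem_iota => hj.
rewrite /columns_of_size big_cat big_map big_allpairs_dep; congr addn.
  rewrite (eq_bigr (fun _ => size (codes k (j + 1) (n - j)))).
    by rewrite big_const_seq count_predT size_iota iter_addn_0 mulnC.
  by move=> t _ /=; rewrite /width !addn0.
rewrite (eq_big_seq (fun _ => (w - 2) * size (codes k (j + 2) (n - j)))%N).
  by rewrite big_const_seq count_predT size_iota iter_addn_0 mulnC mulnA.
move=> a; rewrite mem_iota => ha.
rewrite (eq_bigr (fun _ => size (codes k (j + 2) (n - j)))).
  by rewrite big_const_seq count_predT size_iota iter_addn_0 mulnC.
move=> t _ /=; rewrite /width; congr (size (codes _ _ _)); move: ha; clear; lia.
Qed.

(** Fixing the relative height of the first column to 0 selects one code per translation class. *)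
Definition polyomino_codes (n : nat) : seq (seq (int * nat * nat)) :=
  [seq (0, a, 0%N) :: s | a <- iota 1 n, s <- codes n (width a 0) (n - a)].

Lemma polyomino_codesP (n : nat) s : s \in polyomino_codes n <->
  exists a t, [/\ (0 < a)%N, valid (width a 0) t, s = (0, a, 0%N) :: t &
                  area s = n].
Proof.
split.
  case/allpairsPdep => a [t [ha ht ->]]; exists a, t.
  move: ha ht; rewrite mem_iota codesP ?leq_subr // => ha /andP[v /eqP ar].
  by rewrite /= ar; split=> //; move: ha; clear; lia.
case=> a [t [a0 v -> ar]]; apply/allpairsPdep; exists a, t.
rewrite mem_iota codesP ?leq_subr // v; split=> //; last apply/eqP.
  by move: ar a0 => /=; clear; lia.
by move: ar => /=; clear; lia.
Qed.

Lemma uniq_polyomino_codes (n : nat) : uniq (polyomino_codes n).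
Proof.
apply: allpairs_uniq_dep; first exact: iota_uniq.
  by move=> *; exact: uniq_codes.
by move=> [a s] [a' s'] _ _ /= [-> ->].
Qed.

Lemma translation_class_inj (n : nat) s s' :
  s \in polyomino_codes n -> s' \in polyomino_codes n ->
  translation_class (cells 0 0 s) = translation_class (cells 0 0 s') -> s = s'.
Proof.
move=> /polyomino_codesP[a [t [a0 v -> _]]] /polyomino_codesP[a' [t' [a'0 v' -> _]]].
move=> /(congr1 (fun A => A (cells 0 0 ((0, a, 0%N) :: t)))) e.
have : translation_class (cells 0 0 ((0, a', 0%N) :: t')) (cells 0 0 ((0, a, 0%N) :: t)).
  by rewrite -e; exists (0, 0) => //; rewrite translate_cells !addr0.
case=> -[x y] _; rewrite translate_cells => /esym h.
by have [-> ->] := first_cells_inj _ _ _ _ _ _ _ _ a0 a'0 v v' h.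
Qed.

Lemma translation_class_translate (v : cell) (P : {fset cell}) :
  translation_class (translate v P) = translation_class P.
Proof.
have tt u w (Q : {fset cell}) : translate u (translate w Q) = translate (u + w) Q.
  apply/fsetP => c; rewrite !in_translate /=.
  by congr ((_, _) \in Q); case: u w => [u1 u2] [w1 w2] /=; clear; lia.
apply/seteqP; split=> Q [u _ <-]; rewrite ?tt; first by exists (u + v).
by exists (u - v); rewrite ?tt ?subrK.
Qed.

(** Decoding and then taking the translation class is a bijection from codes to classes. Writing the
    classes as a finite set also rules out the default value of [fset_set]. *)
Lemma cheesy_count_codes (n : nat) :
  cheesy_count 1 n = size (polyomino_codes n).
Proof.
pose X := [fset translation_class (cells 0 0 s) | s in polyomino_codes n].
have -> : cheesy_count 1 n = #|` X|.
  rewrite /cheesy_count (_ : cheesy_classes 1 n = [set` X]%classic) ?set_fsetK //.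
  apply/seteqP; split=> Q /=.
    case=> P [/cheesyP[x [y [a [s [a0 v PE]]]]] ar] <-.
    apply/imfsetP; exists ((0, a, 0%N) :: s).
      apply/polyomino_codesP; exists a, s; split=> //.
      by rewrite -(card_cells x y) -PE.
    by rewrite PE -[x]addr0 -[y in LHS]addr0 -translate_cells translation_class_translate.
  case/imfsetP => s /polyomino_codesP[a [t [a0 v sE ar]]] ->.
  exists (cells 0 0 s) => //; split; first by rewrite sE; exact: cheesy_cells.
  by rewrite card_cells.
rewrite card_in_imfset /=.
  by rewrite undup_id // uniq_polyomino_codes.
by move=> s s' hs hs'; exact: translation_class_inj hs hs'.
Qed.

(** * The linear recurrence *)

(* P0, P1 and Q0 are the convolutions of p with 1, of p with j, and of q with 1, where j is the size
   of the next column.  The renewal equation also involves that of p with j^2 and that of q with j,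
   but only through their sum, which always equals Q0 + 2 P0.  The initial value is obtained by
   running the recurrence backwards from the state (0, 0, 1) of index 1. *)
Definition state_step (v : int * int * int) : int * int * int :=
  let: (P0, P1, Q0) := v in
  let p := Q0 + P0 + 2 * P1 in let q := P0 - 2 * P1 in
  (P0 + p, P1 + P0 + p, Q0 + q).

Definition state (n : nat) : int * int * int := iter n state_step (-1, 0, 2).

(** [slope] and [intercept] are the coefficients p_n and q_n. At 0 only the empty completion exists,
    whatever the width, which imposes the values 0 and 1; the general formulas would give 1 and -1
    there. *)
Definition slope (n : nat) : int :=
  if n == 0%N then 0 else
  let: (P0, P1, Q0) := state n in Q0 + P0 + 2 * P1.

Definition intercept (n : nat) : int :=
  if n == 0%N then 1 else let: (P0, P1, Q0) := state n in P0 - 2 * P1.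

Definition moment (k n : nat) (u : nat -> int) : int :=
  \sum_(i < n) (n%:Z - (i : nat)%:Z) ^+ k * u i.

(** In this lemma and the next two, passing from [n] to [n.+1] turns each weight j^k into (j + 1)^k,
    expanded by the binomial formula, and adds the index [n] with weight 1. *)
Lemma moment0S (n : nat) (u : nat -> int) :
  moment 0 n.+1 u = moment 0 n u + u n.
Proof.
by rewrite /moment big_ord_recr /= expr0 mul1r; congr (_ + _).
Qed.

Lemma moment1S (n : nat) (u : nat -> int) :
  moment 1 n.+1 u = moment 1 n u + moment 0 n u + u n.
Proof.
rewrite /moment big_ord_recr /= -big_split /=; congr (_ + _).
  by apply: eq_bigr => i _; rewrite intS; ring.
by rewrite intS; ring.
Qed.

Lemma moment2S (n : nat) (u : nat -> int) :
  moment 2 n.+1 u = moment 2 n u + 2 * moment 1 n u + moment 0 n u + u n.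
Proof.
rewrite /moment big_ord_recr /= mulr_sumr -!big_split /=; congr (_ + _).
  by apply: eq_bigr => i _; rewrite intS; ring.
by rewrite intS; ring.
Qed.

(** In the induction the last identity reduces to p = Q0 + P0 + 2 P1, which is the formula for
    [slope]. It is what closes the system on three unknowns. *)
Lemma moments_state (n : nat) :
  let: (P0, P1, Q0) := state n.+1 in
  [/\ moment 0 n.+1 slope = P0, moment 1 n.+1 slope = P1,
      moment 0 n.+1 intercept = Q0 &
      moment 2 n.+1 slope + moment 1 n.+1 intercept = Q0 + 2 * P0].
Proof.
elim: n => [|n].
  by rewrite /= /moment !big_ord1.
have -> : state n.+2 = state_step (state n.+1) by [].
rewrite !(moment0S n.+1, moment1S n.+1, moment2S n.+1).
have : slope n.+1 = let: (P0, P1, Q0) := state n.+1 in Q0 + P0 + 2 * P1 by [].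
have : intercept n.+1 = let: (P0, P1, Q0) := state n.+1 in P0 - 2 * P1 by [].
case: (state n.+1) => [[P0 P1] Q0] -> -> [-> -> -> h] /=.
by split=> //; move: h; clear; lia.
Qed.

Lemma sum_iota_rev (n : nat) (G : nat -> nat -> nat) :
  (\sum_(j <- iota 1 n) G j (n - j) = \sum_(i < n) G (n - i) i)%N.
Proof.
have -> : iota 1 n = index_iota 1 n.+1 by rewrite /index_iota subn1.
rewrite big_add1 /= big_mkord.
rewrite (reindex_inj rev_ord_inj) /=; apply: eq_bigr => i _.
have h := ltn_ord i; congr G; move: h; clear; lia.
Qed.

(** The affine form is substituted in the sum over the next column. The bound on [w] makes the
    truncated difference [w - 2] an integer difference. *)
Lemma size_codes_linear (k w n : nat) : (n <= k)%N -> (2 <= w)%N ->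
  (size (codes k w n))%:Z = slope n * w%:Z + intercept n.
Proof.
elim: k w n => [|k IH] w n nk w2.
  by move: nk; rewrite leqn0 => /eqP ->.
have [->|n0] := posnP n; first by [].
rewrite size_codes // (sum_iota_rev n (fun j i => (w + j - 1) * size (codes k (j + 1) i) +
     (j - 1) * (w - 2) * size (codes k (j + 2) i)))%N.
rewrite -natz natr_sum.
(* With j = n - i, the coefficient of [w] collects p_i (j^2 + 2 j - 1) + q_i j, and the constant
   term p_i (3 - 2 j - j^2) + q_i (1 - j). *)
transitivity (w%:Z * (moment 2 n slope + 2 * moment 1 n slope -
    moment 0 n slope + moment 1 n intercept) +
  (3 * moment 0 n slope - 2 * moment 1 n slope - moment 2 n slope -
    moment 1 n intercept + moment 0 n intercept)).
  rewrite /moment !mulr_sumr -!sumrN -!big_split /= mulr_sumr -big_split /=.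
  apply: eq_bigr => i _.
  have hi := ltn_ord i; rewrite natrD !natrM !natz.
  rewrite !IH; try by move: hi nk; clear; lia.
  have -> : (w + (n - i) - 1)%N%:Z = w%:Z + (n%:Z - (i : nat)%:Z) - 1 by move: hi; clear; lia.
  have -> : (n - i - 1)%N%:Z = (n%:Z - (i : nat)%:Z) - 1 by move: hi; clear; lia.
  have -> : (n - i + 1)%N%:Z = (n%:Z - (i : nat)%:Z) + 1 by move: hi; clear; lia.
  have -> : (n - i + 2)%N%:Z = (n%:Z - (i : nat)%:Z) + 2 by move: hi; clear; lia.
  have -> : (w - 2)%N%:Z = w%:Z - 2 by move: w2; clear; lia.
  by ring.
case: n n0 {nk} => // n _; have := moments_state n.
have : slope n.+1 = let: (P0, P1, Q0) := state n.+1 in Q0 + P0 + 2 * P1 by [].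
have : intercept n.+1 = let: (P0, P1, Q0) := state n.+1 in P0 - 2 * P1 by [].
(* The last invariant eliminates the moment of order 2, and the first moment of [intercept] then
   cancels. *)
case: (state n.+1) => [[P0 P1] Q0] -> -> [-> -> ->] /(canRL (addrK _)) ->.
by ring.
Qed.

(** A first column of j cells has width j + 1 and contributes p_i (j + 1) + q_i with i = n - j. *)
Lemma size_polyomino_codes (n : nat) : (0 < n)%N ->
  (size (polyomino_codes n))%:Z =
  let: (P0, P1, Q0) := state n in P0 + P1 + Q0.
Proof.
move=> n0; rewrite /polyomino_codes size_allpairs_dep sumnE big_map.
rewrite (sum_iota_rev n (fun j i => size (codes n (width j 0) i))).
rewrite -natz natr_sum.
transitivity (moment 1 n slope + moment 0 n slope + moment 0 n intercept).
  rewrite /moment -!big_split /=; apply: eq_bigr => i _.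
  have hi := ltn_ord i; rewrite natz size_codes_linear.
  - have -> : (width (n - i) 0)%:Z = n%:Z - (i : nat)%:Z + 1.
      by rewrite /width; move: hi; clear; lia.
    by ring.
  - exact: ltnW.
  - by rewrite /width; move: hi; clear; lia.
case: n n0 => // n _; have := moments_state n.
by case: (state n.+1) => [[P0 P1] Q0] [-> -> -> _]; ring.
Qed.

(** Cayley-Hamilton: [state_step] is linear with characteristic polynomial x^3 - 6 x^2 + 8 x - 1.
    Indices start at 1 because the state of index 0 gives 1 while no polyomino has 0 cells. *)
Lemma cheesy_count_rec (n : nat) :
  (cheesy_count 1 n.+4)%:Z = 6 * (cheesy_count 1 n.+3)%:Z -
    8 * (cheesy_count 1 n.+2)%:Z + (cheesy_count 1 n.+1)%:Z.
Proof.
rewrite !cheesy_count_codes !size_polyomino_codes //=.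
by case: (state_step (state n)) => [[P0 P1] Q0] /=; ring.
Qed.

Lemma cheesy_count_123 :
  [/\ cheesy_count 1 1 = 1%N, cheesy_count 1 2 = 3%N & cheesy_count 1 3 = 11%N].
Proof.
by rewrite !cheesy_count_codes; split; apply/eqP; rewrite -eqz_nat size_polyomino_codes.
Qed.

(** * Asymptotics *)

(** Intermediate value theorem, applied to the cubic or to its opposite according to the direction
    of the sign change. *)
Lemma cubic_root (R : realType) (a b : R) : a <= b ->
  (a ^+ 3 - 6 * a ^+ 2 + 8 * a - 1) * (b ^+ 3 - 6 * b ^+ 2 + 8 * b - 1) <= 0 ->
  exists2 r, a <= r <= b & r ^+ 3 - 6 * r ^+ 2 + 8 * r - 1 = 0.
Proof.
move=> ab sg; pose p : {poly R} := 'X^3 - 6%:P * 'X^2 + 8%:P * 'X - 1%:P.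
have pE x : p.[x] = x ^+ 3 - 6 * x ^+ 2 + 8 * x - 1 by rewrite !hornerE.
have [r rab /eqP pr] : exists2 r, a <= r <= b & root p r.
  have [pa|pa] := leP p.[a] 0.
    have [pb|pb] := leP 0 p.[b]; first by apply: poly_ivt => //; rewrite pa.
    (* Here [p.[a] <= 0] and [p.[b] < 0], so the sign condition forces [p.[a] = 0]. *)
    exists a; first by rewrite lexx.
    by apply/rootP; move: sg; rewrite -!pE; nra.
  have [r rab rp] : exists2 r, a <= r <= b & root (- p) r.
    apply: poly_ivt => //; rewrite !hornerN oppr_le0 oppr_ge0 (ltW pa) /=.
    by move: sg; rewrite -!pE; nra.
  by exists r => //; rewrite rootN in rp.
by exists r; rewrite // -pE.
Qed.

(** After division by [A * l ^+ n] the two other terms are geometric with ratios of absolute value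
    below 1. *)
Lemma ratio_cvg1 (R : realType) (u : nat -> R) (A B C l m v : R) :
  A != 0 -> 0 < l -> `|m| < l -> `|v| < l ->
  (forall n, u n.+1 = A * l ^+ n.+1 + B * m ^+ n.+1 + C * v ^+ n.+1) ->
  u n / (A * l ^+ n) @[n --> \oo] --> (1 : R).
Proof.
move=> A0 l0 ml vl uE.
have geo (D z : R) : `|z| < l -> D / A * (z / l) ^+ n @[n --> \oo] --> (0 : R).
  move=> zl; apply: cvg_geometric.
  by rewrite normrM normfV (gtr0_norm l0) ltr_pdivrMr ?mul1r.
have H : 1 + B / A * (m / l) ^+ n + C / A * (v / l) ^+ n @[n --> \oo] --> (1 : R).
  rewrite -[X in _ --> X]addr0 -[X in _ --> X + _]addr0.
  by apply: cvgD; [apply: cvgD; [exact: cvg_cst|exact: geo]|exact: geo].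
apply: cvg_trans H; apply: near_eq_cvg; near=> n.
have n0 : (0 < n)%N by near: n; exact: nbhs_infty_gt.
rewrite /= -(prednK n0) uE !expr_div_n.
have ln0 : l ^+ n.-1.+1 != 0 by rewrite expf_neq0 // gt_eqF.
by move: (l ^+ _) ln0 => L L0; field; rewrite L0 A0.
Unshelve. all: by end_near.
Qed.

Lemma recurrence3_ext (T : Type) (f : T -> T -> T -> T) (u w : nat -> T) :
  (forall n, u n.+3 = f (u n) (u n.+1) (u n.+2)) ->
  (forall n, w n.+3 = f (w n) (w n.+1) (w n.+2)) ->
  u 0%N = w 0%N -> u 1%N = w 1%N -> u 2%N = w 2%N -> u =1 w.
Proof.
move=> ur wr e0 e1 e2 n.
suff : [/\ u n = w n, u n.+1 = w n.+1 & u n.+2 = w n.+2] by case.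
by elim: n => // n [h0 h1 h2]; split=> //; rewrite ur wr h0 h1 h2.
Qed.

Theorem corollary2 (R : realType) :
  exists kappa lambda : R,
    [/\ 144 / 10 ^+ 3 + 176 / 10 ^+ 6 <= kappa
          < 144 / 10 ^+ 3 + 177 / 10 ^+ 6,
        4 + 114 / 10 ^+ 3 + 907 / 10 ^+ 6 <= lambda
          < 4 + 114 / 10 ^+ 3 + 908 / 10 ^+ 6
      & (cheesy_count 1 n)%:R / (kappa * lambda ^+ n) @[n --> \oo] --> (1 : R)].
Proof.
(* A bracket of length 10^-7, finer than the decimals of [lambda], because [kappa] is also estimated
   from it. *)
have [||l lI lr] := @cubic_root R (4 + 114 / 10 ^+ 3 + 907 / 10 ^+ 6 + 5 / 10 ^+ 7)
  (4 + 114 / 10 ^+ 3 + 907 / 10 ^+ 6 + 6 / 10 ^+ 7).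
- by lra.
- by lra.
have [||m mI mr] := @cubic_root R 0 1; [by lra|by lra|].
have [||v vI vr] := @cubic_root R (3 / 2) 2; [by lra|by lra|].
have lm : l - m != 0 by apply/eqP; lra.
have lv : l - v != 0 by apply/eqP; lra.
have mv : m - v != 0 by apply/eqP; lra.
have ml : m - l != 0 by apply/eqP; lra.
have vl : v - l != 0 by apply/eqP; lra.
have vm : v - m != 0 by apply/eqP; lra.
(* Vieta: the combination of the three equations below is the Vandermonde product (l - m)(l - v)(m -
   v) times l + m + v - 6. *)
have sum3 : l + m + v = 6.
  apply/eqP; rewrite -subr_eq0; apply/eqP.
  apply: (mulfI lm); apply: (mulfI lv); apply: (mulfI mv).
  have := congr1 (fun z => (m - v) * z) lr.
  have := congr1 (fun z => (v - l) * z) mr.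
  have := congr1 (fun z => (l - m) * z) vr.
  by rewrite /= !mulr0; lra.
have vE : v = 6 - l - m by lra.
have prod3 : m * v = 8 - l * (6 - l).
  by apply: (mulfI lm); rewrite vE; lra.
(* Lagrange interpolation from the values 1, 1, 3 of the sequence at 0, 1, 2 *)
pose A (r s t : R) := (3 - (s + t) + s * t) / ((r - s) * (r - t)).
(* The sum and product of the other two roots are polynomials in [l], and (l - m)(l - v) is the
   derivative of the cubic at [l]. *)
have AE : A l m v = (l ^+ 2 - 5 * l + 5) / (3 * l ^+ 2 - 12 * l + 8).
  rewrite /A; congr (_ / _); first by lra.
  by have := congr1 (fun z => l * z) sum3; rewrite /=; lra.
have AI : 144 / 10 ^+ 3 + 176 / 10 ^+ 6 <= A l m v
    < 144 / 10 ^+ 3 + 177 / 10 ^+ 6.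
  rewrite AE ler_pdivlMr ?ltr_pdivrMr; nra.
have sum_pow (k : nat) (c : R) : (k < 3)%N -> c = nth 0 [:: 1; 1; 3] k ->
    A l m v * l ^+ k + A m l v * m ^+ k + A v l m * v ^+ k = c.
  by case: k => [|[|[|//]]] _ ->; rewrite /A /=; field;
    rewrite ?lm ?lv ?mv ?ml ?vl ?vm.
have rec (r : R) : r ^+ 3 - 6 * r ^+ 2 + 8 * r - 1 = 0 -> forall k,
    r ^+ k.+3 = 6 * r ^+ k.+2 - 8 * r ^+ k.+1 + r ^+ k.
  by move=> e k; have := congr1 (fun z => r ^+ k * z) e; rewrite /= !exprS; lra.
exists (A l m v), l; split; [lra|lra|].
apply: (@ratio_cvg1 R _ _ (A m l v) (A v l m) l m v).
- by apply/eqP; lra.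
- by lra.
- by rewrite ltr_norml; lra.
- by rewrite ltr_norml; lra.
have [c1 c2 c3] := cheesy_count_123.
have S0 := sum_pow 0%N 1 isT erefl.
have S1 := sum_pow 1%N 1 isT erefl.
have S2 := sum_pow 2%N 3 isT erefl.
apply: (@recurrence3_ext _ (fun x y z => 6 * z - 8 * y + x)).
- move=> n; have /(congr1 (fun z : int => z%:~R : R)) := cheesy_count_rec n.
  by rewrite rmorphD rmorphB !rmorphM.
- by move=> n; rewrite !(rec _ lr) !(rec _ mr) !(rec _ vr); ring.
- by rewrite c1 S1.
- by rewrite c2 S2.
(* This is 11 = 6 * 3 - 8 * 1 + 1. The closed form takes at 0 the value 1 given by the recurrence
   run backwards, not the count 0. *)
rewrite c3 (rec _ lr) (rec _ mr) (rec _ vr).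
move: (A l m v) (A m l v) (A v l m) S0 S1 S2 => a b c; clear; lra.
Qed.
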